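(* Let $\mathbf{w}\in\mathcal{K}_{m+}\setminus\{\mathbf{0}\}\subset\mathbb{R}^n$, $\varepsilon>0$, and $\mathbf{g}\in\mathbb{R}^n$. For $i=1,\dots,n$ let $\tau_i=\bigl(\sum_{j=1}^i w_j\bigr)^{-1}$ and let $\mathbf{b}^{(i)}\in\mathbb{R}^n$ be the vector whose first $i$ entries equal $\tau_i$ and whose remaining entries equal $0$; let $\mathcal{B}=\{\mathbf{b}^{(1)},\dots,\mathbf{b}^{(n)}\}$. If $\hat{\mathbf{b}}\in\arg\max_{\mathbf{b}\in\mathcal{B}}\mathbf{b}^T|\mathbf{g}|_{\downarrow}$, then $$\mathbf{s}=\varepsilon\;\mathrm{sign}(\mathbf{g})\odot\bigl(\mathbf{P}(|\mathbf{g}|)^T\,\hat{\mathbf{b}}\bigr)$$ is a solution of the linear problem $\max\{\mathbf{s}^T\mathbf{g}:\ \mathbf{s}\in\mathbb{R}^n,\ \Omega_{\mathbf{w}}(\mathbf{s})\le\varepsilon\}$.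
   Context: $\mathcal{K}_{m+}=\{\mathbf{x}\in\mathbb{R}^n: x_1\ge x_2\ge\cdots\ge x_n\ge 0\}$ is the monotone non-negative cone. For $\mathbf{x}\in\mathbb{R}^n$, $|\mathbf{x}|$ is the vector of absolute values of its components, $|\mathbf{x}|_{\downarrow}$ is that vector sorted in non-increasing order, and $\mathbf{P}(|\mathbf{x}|)$ is a permutation matrix (ties broken arbitrarily) such that $|\mathbf{x}|_{\downarrow}=\mathbf{P}(|\mathbf{x}|)\,|\mathbf{x}|$. The ordered weighted $\ell_1$ (OWL) norm is $\Omega_{\mathbf{w}}(\mathbf{x})=\mathbf{w}^T|\mathbf{x}|_{\downarrow}$. $\mathrm{sign}$ is applied component-wise and $\odot$ is the entry-wise product. *)

(* Defs.v *)
From mathcomp Require Import all_boot all_order all_algebra.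
From mathcomp Require Import classical_sets reals.

Set Implicit Arguments.
Unset Strict Implicit.
Unset Printing Implicit Defensive.

Import Order.TTheory GRing.Theory Num.Theory.
Local Open Scope classical_set_scope.
Local Open Scope ring_scope.

Definition dotv (R : realType) (n : nat) (x y : 'cV[R]_n) : R :=
  (x^T *m y) 0 0.

Definition absv (R : realType) (n : nat) (x : 'cV[R]_n) : 'cV[R]_n :=
  map_mx (fun a : R => `|a|) x.

Definition signv (R : realType) (n : nat) (x : 'cV[R]_n) : 'cV[R]_n :=
  map_mx (fun a : R => Num.sg a) x.

Definition hadamard (R : realType) (n : nat) (x y : 'cV[R]_n) : 'cV[R]_n :=
  map2_mx (fun a b : R => a * b) x y.

(* The components of x in non-increasing order; the sorted sequence has size
   n, so the default value of nth is never used. *)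
Definition sort_down (R : realType) (n : nat) (x : 'cV[R]_n) : 'cV[R]_n :=
  \col_(i < n) nth 0 (sort >=%R [seq x j 0 | j <- enum 'I_n]) i.

Definition monotone_nonneg_cone (R : realType) (n : nat) : set 'cV[R]_n :=
  [set x | (forall i j : 'I_n, (i <= j)%N -> x j 0 <= x i 0) /\
           (forall i : 'I_n, 0 <= x i 0)].
Arguments monotone_nonneg_cone : clear implicits.

Definition owl_norm (R : realType) (n : nat) (w x : 'cV[R]_n) : R :=
  dotv w (sort_down (absv x)).

(* Indices start at 0: tau w i and owl_atom w i are tau_{i+1} and b^{(i+1)}. *)
Definition tau (R : realType) (n : nat) (w : 'cV[R]_n) (i : 'I_n) : R :=
  (\sum_(j < n | (j <= i)%N) w j 0)^-1.

Definition owl_atom (R : realType) (n : nat) (w : 'cV[R]_n) (i : 'I_n) :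
    'cV[R]_n :=
  \col_(j < n) (if (j <= i)%N then tau w i else 0).

Definition owl_atoms (R : realType) (n : nat) (w : 'cV[R]_n) : set 'cV[R]_n :=
  range (owl_atom w).

Definition argmax (R : realType) (T : Type) (A : set T) (f : T -> R) : set T :=
  [set x | A x /\ forall y, A y -> f y <= f x].

(* Main.v *)
(** Write [a] for the sorted vector |g|_down and [M] for the maximum of
    [b^T a] over the atoms. Maximality of [M] says exactly that every partial
    sum of [a] is at most [M] times the corresponding partial sum of [w], so by
    Abel summation [u^T a <= M w^T u] for every [u] in the cone. For feasible
    [s] the rearrangement inequality gives
    [s^T g <= |s|_down^T a <= M Omega_w(s) <= M eps], and this value is attained
    by the proposed solution. The rearrangement inequality is itself an instance
    of Abel summation, applied to the differences of [a] and its permutation. *)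
Require Import Defs.
From mathcomp Require Import all_boot all_order all_algebra all_fingroup.
From mathcomp Require Import classical_sets reals.

Import Order.TTheory GRing.Theory Num.Theory.
Local Open Scope classical_set_scope.
Local Open Scope ring_scope.

(** Summation by parts: the sum is the last [u] times the total of [c], plus the partial sums of [c]
    weighted by the successive drops of [u], and all of these are nonnegative. *)
Lemma abel_sum_ge0 (R : realDomainType) (n : nat) (u c : 'I_n -> R) :
  (forall i j : 'I_n, (i <= j)%N -> u j <= u i) ->
  (forall i, 0 <= u i) ->
  (forall i : 'I_n, 0 <= \sum_(j < n | (j <= i)%N) c j) ->
  0 <= \sum_(j < n) u j * c j.
Proof.
case: n u c => [|n] u c u_noninc u_ge0 c_ge0; first by rewrite big_ord0.
have sum_le_max m (f : 'I_m.+1 -> R) :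
    \sum_(j < m.+1 | (j <= @ord_max m)%N) f j = \sum_j f j.
  by apply: eq_bigl => j; rewrite leq_ord.
(* This sharper bound carries the induction: nonnegativity of the shorter sum alone could not absorb
   a negative last term, whereas here the last terms cancel. *)
suff: u ord_max * (\sum_j c j) <= \sum_j u j * c j.
  apply: le_trans; apply: mulr_ge0 => //.
  by have := c_ge0 ord_max; rewrite sum_le_max.
elim: n u c u_noninc u_ge0 c_ge0 => [|n IHn] u c u_noninc u_ge0 c_ge0.
  by rewrite !big_ord1 (ord1 ord_max).
rewrite big_ord_recr [leRHS]big_ord_recr /= mulrDr lerD2r.
have c'_ge0 (i : 'I_n.+1) :
    0 <= \sum_(j < n.+1 | (j <= i)%N) c (widen_ord (leqnSn _) j).
  have := c_ge0 (widen_ord (leqnSn _) i).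
  by rewrite big_mkcond big_ord_recr /= leqNgt ltn_ord addr0 -big_mkcond.
apply: le_trans (IHn _ _ _ _ c'_ge0) => [|i j le_ij|i] //; last exact: u_noninc.
apply: ler_wpM2r; last by apply: u_noninc; rewrite /= leqnSn.
by have := c'_ge0 ord_max; rewrite sum_le_max.
Qed.

Lemma perm_partial_sum_le (R : realDomainType) (n : nat) (a : 'I_n -> R)
    (p : 'S_n) (i : 'I_n) :
  (forall i j : 'I_n, (i <= j)%N -> a j <= a i) ->
  \sum_(j < n | (j <= i)%N) a (p j) <= \sum_(j < n | (j <= i)%N) a j.
Proof.
move=> a_noninc.
(* Shifting by [a i] makes the first [i + 1] terms nonnegative and the others
   nonpositive. *)
pose d j := a j - a i.
have shift (f : 'I_n -> 'I_n) : \sum_(j < n | (j <= i)%N) a (f j)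
    = \sum_(j < n | (j <= i)%N) d (f j) + \sum_(j < n | (j <= i)%N) a i.
  by rewrite -big_split; apply: eq_bigr => j _; rewrite /= /d subrK.
rewrite (shift p) (shift id) lerD2r.
(* The left side becomes the sum of [d j] over the [j] with [p^-1 j <= i], so both sides can be
   compared term by term. *)
rewrite (reindex_inj (@perm_inj _ p^-1%g)) /=.
rewrite [leLHS]big_mkcond [leRHS]big_mkcond; apply: ler_sum => j _.
rewrite permKV /d; case: (leqP j i) => ji; case: ifP => _ //.
- by rewrite subr_ge0 a_noninc.
- by rewrite subr_le0 a_noninc // ltnW.
Qed.

Lemma rearrangement_le (R : realDomainType) (n : nat) (u a : 'I_n -> R)
    (p : 'S_n) :
  (forall i j : 'I_n, (i <= j)%N -> u j <= u i) ->
  (forall i, 0 <= u i) ->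
  (forall i j : 'I_n, (i <= j)%N -> a j <= a i) ->
  \sum_(j < n) u j * a (p j) <= \sum_(j < n) u j * a j.
Proof.
move=> u_noninc u_ge0 a_noninc; rewrite -subr_ge0 -sumrB.
under eq_bigr do rewrite -mulrBr.
apply: abel_sum_ge0 => // i.
by rewrite sumrB subr_ge0 perm_partial_sum_le.
Qed.

Lemma dotvE (R : realType) (n : nat) (x y : 'cV[R]_n) :
  dotv x y = \sum_(j < n) x j 0 * y j 0.
Proof. by rewrite /dotv mxE; apply: eq_bigr => j _; rewrite mxE. Qed.

Lemma perm_mx_colE (R : realType) (n : nat) (p : 'S_n) (x : 'cV[R]_n) i :
  (perm_mx p *m x) i 0 = x (p i) 0.
Proof. by rewrite -row_permE mxE. Qed.

Lemma sort_down_perm {R : realType} {n : nat} (x : 'cV[R]_n) :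
  exists p : 'S_n, forall i, sort_down x i 0 = x (p i) 0.
Proof.
pose t := [tuple x j 0 | j < n].
have /tuple_permP[p sort_p] : perm_eq (sort >=%R t) t by rewrite perm_sort.
by exists p => i; rewrite mxE sort_p -tnth_nth !tnth_mktuple.
Qed.

Lemma sort_down_noninc {R : realType} {n : nat} (x : 'cV[R]_n) (i j : 'I_n) :
  (i <= j)%N -> sort_down x j 0 <= sort_down x i 0.
Proof.
move=> le_ij; rewrite !mxE.
have sorted_x : sorted >=%R (sort >=%R [seq x k 0 | k <- enum 'I_n]).
  by apply: sort_sorted => a b; exact: ge_total.
apply: (sorted_leq_nth _ _ 0 sorted_x) => //.
- by move=> b a c ba cb; exact: le_trans cb ba.
- by move=> a; exact: lexx.
- by rewrite inE size_sort size_map size_enum_ord.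
- by rewrite inE size_sort size_map size_enum_ord.
Qed.

Lemma sort_down_absv_ge0 {R : realType} {n : nat} (x : 'cV[R]_n) (i : 'I_n) :
  0 <= sort_down (absv x) i 0.
Proof. by have [p ->] := sort_down_perm (absv x); rewrite mxE. Qed.

Lemma dotv_le_sort_down_absv (R : realType) (n : nat) (x y : 'cV[R]_n) :
  dotv x y <= dotv (sort_down (absv x)) (sort_down (absv y)).
Proof.
have [p xp] := sort_down_perm (absv x).
have [q yq] := sort_down_perm (absv y).
rewrite !dotvE.
apply: (@le_trans _ _ (\sum_j absv x j 0 * absv y j 0)).
  by apply: ler_sum => j _; rewrite !mxE -normrM ler_norm.
rewrite (reindex_inj (@perm_inj _ p)) /=.
(* With [|x|] sorted by [p], the other factor is the sorted [|y|] permuted by [p * q^-1]. *)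
under eq_bigr => j _.
  rewrite -xp -(permKV q (p j)) -yq -permM; over.
apply: rearrangement_le; [|exact: sort_down_absv_ge0|];
  exact: sort_down_noninc.
Qed.

(** The first entry of [w] is the largest, hence positive as [w] is nonzero, and it occurs in every
    partial sum. So each [tau w i] is the inverse of a positive number. *)
Lemma cone_partial_sum_gt0 {R : realType} {n : nat} {w : 'cV[R]_n} (i : 'I_n) :
  (monotone_nonneg_cone R n `\ 0) w -> 0 < \sum_(j < n | (j <= i)%N) w j 0.
Proof.
case: n w i => [|n] w i; first by case: i.
move=> [[w_noninc w_ge0] w_neq0].
have w0_gt0 : 0 < w ord0 0.
  rewrite lt0r w_ge0 andbT; apply/eqP => w0; apply: w_neq0.
  apply/colP => j; rewrite mxE; apply/eqP.
  by rewrite eq_le w_ge0 andbT -w0 w_noninc.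
by rewrite (bigD1 ord0) //=; apply: ltr_wpDr => //; apply: sumr_ge0.
Qed.

Lemma dotv_owl_atom (R : realType) (n : nat) (w x : 'cV[R]_n) (i : 'I_n) :
  dotv (owl_atom w i) x = tau w i * \sum_(j < n | (j <= i)%N) x j 0.
Proof.
rewrite dotvE big_distrr /= [RHS]big_mkcond; apply: eq_bigr => j _.
by rewrite mxE; case: ifP => _ //; rewrite mul0r.
Qed.

Lemma dotvC (R : realType) (n : nat) (x y : 'cV[R]_n) : dotv x y = dotv y x.
Proof. by rewrite !dotvE; apply: eq_bigr => j _; rewrite mulrC. Qed.

Lemma dotv_sort_down_le (R : realType) (n : nat) (w x y : 'cV[R]_n) (M : R) :
  (monotone_nonneg_cone R n `\ 0) w ->
  (forall i, dotv (owl_atom w i) y <= M) ->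
  dotv (sort_down (absv x)) y <= M * owl_norm w x.
Proof.
move=> w_cone y_le; rewrite /owl_norm dotvC !dotvE mulr_sumr -subr_ge0 -sumrB.
have -> : \sum_j (M * (w j 0 * sort_down (absv x) j 0)
                  - y j 0 * sort_down (absv x) j 0)
        = \sum_j sort_down (absv x) j 0 * (M * w j 0 - y j 0).
  by apply: eq_bigr => j _; rewrite mulrA -mulrBl mulrC.
apply: abel_sum_ge0 => [||i]; first exact: sort_down_noninc.
  exact: sort_down_absv_ge0.
rewrite sumrB -mulr_sumr subr_ge0 -ler_pdivrMr ?cone_partial_sum_gt0 //.
by have := y_le i; rewrite dotv_owl_atom mulrC.
Qed.

(** Gives feasibility of the proposed solution. An atom is non-increasing, so by rearrangement
    permuting it cannot raise its product with [w] above 1, the value fixed by [tau]. The entrywise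
    hypothesis is an inequality because [sg] vanishes at zeros of [g]. *)
Lemma owl_norm_atom_le (R : realType) (n : nat) (w x : 'cV[R]_n) (c : R)
    (p : 'S_n) (i : 'I_n) :
  (monotone_nonneg_cone R n `\ 0) w -> 0 <= c ->
  (forall j, absv x j 0 <= c * owl_atom w i (p j) 0) ->
  owl_norm w x <= c.
Proof.
move=> w_cone c_ge0 x_le; have [[w_noninc w_ge0] _] := w_cone.
have W_gt0 := cone_partial_sum_gt0 i w_cone.
have tau_ge0 : 0 <= tau w i by rewrite invr_ge0 ltW.
have [q xq] := sort_down_perm (absv x).
rewrite /owl_norm dotvE.
apply: (@le_trans _ _ (c * \sum_j w j 0 * owl_atom w i ((q * p)%g j) 0)).
  rewrite mulr_sumr; apply: ler_sum => j _.
  by rewrite xq mulrCA permM; apply: ler_wpM2l.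
rewrite -[leRHS]mulr1; apply: ler_wpM2l => //.
have <- : \sum_j w j 0 * owl_atom w i j 0 = 1.
  by rewrite -dotvE dotvC dotv_owl_atom /tau mulVf // gt_eqF.
apply: (@rearrangement_le _ _ (w ^~ 0) (owl_atom w i ^~ 0)) => // j k le_jk.
rewrite !mxE; case: ifP => [le_ki|_]; first by rewrite (leq_trans le_jk le_ki).
by case: ifP.
Qed.

Theorem mainTheorem6 (R : realType) (n : nat) (w : 'cV[R]_n) (eps : R)
    (g : 'cV[R]_n) (P : 'M[R]_n) (b : 'cV[R]_n)
    (w_cone : (monotone_nonneg_cone R n `\ 0) w)
    (eps_gt0 : 0 < eps)
    (P_perm : is_perm_mx P)
    (P_sorts : sort_down (absv g) = P *m absv g)
    (b_argmax :
       argmax (owl_atoms w) (fun c => dotv c (sort_down (absv g))) b) :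
  argmax [set s : 'cV[R]_n | owl_norm w s <= eps]
         (fun s => dotv s g)
         (eps *: hadamard (signv g) (P^T *m b)).
Proof.
have /is_perm_mxP[p Pp] := P_perm; have [[k _ bk] b_max] := b_argmax.
have Wk_gt0 := cone_partial_sum_gt0 k w_cone.
have b_ge0 j : 0 <= b j 0.
  by rewrite -bk mxE; case: ifP => // _; rewrite invr_ge0 ltW.
have sE j : (eps *: hadamard (signv g) (P^T *m b)) j 0
    = eps * (Num.sg (g j 0) * b (p^-1%g j) 0).
  by rewrite Pp tr_perm_mx mxE mxE perm_mx_colE mxE.
split=> /= [|s s_le].
  apply: (@owl_norm_atom_le _ _ _ _ _ p^-1%g k) => // [|j]; first exact: ltW.
  rewrite bk mxE sE !normrM (gtr0_norm eps_gt0) (ger0_norm (b_ge0 _)).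
  apply: ler_wpM2l; first exact: ltW.
  by apply: ler_piMl => //; rewrite normr_sg lern1 leq_b1.
(* The candidate attains the bound: [sg a * a] is [|a|], and reindexing by [p] moves [P^T] from [b]
   to [P] on [|g|]. *)
have -> : dotv (eps *: hadamard (signv g) (P^T *m b)) g
    = dotv b (sort_down (absv g)) * eps.
  rewrite P_sorts !dotvE [RHS]mulrC mulr_sumr.
  rewrite (reindex_inj (@perm_inj _ p)) /=; apply: eq_bigr => j _.
  rewrite sE Pp perm_mx_colE mxE permK normrEsg.
  by rewrite -!mulrA; congr (_ * _); rewrite mulrCA.
(* The sign of the maximum is what allows multiplying [owl_norm w s <= eps] by it at the end. *)
have M_ge0 : 0 <= dotv b (sort_down (absv g)).
  rewrite dotvE; apply: sumr_ge0 => j _.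
  by rewrite mulr_ge0 ?sort_down_absv_ge0.
apply: le_trans (dotv_le_sort_down_absv _ _ _ _) _.
apply: le_trans (_ : _ <= dotv b (sort_down (absv g)) * owl_norm w s) _.
  by apply: dotv_sort_down_le => // i; apply: b_max; exists i.
exact: ler_wpM2l.
Qed.
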